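(* Let $n\ge0$ be a fixed integer and $\eta>0$ a fixed constant. Let $\delta_0>0$ be such that (A1) $\boldsymbol f$ is twice continuously differentiable on $B(\boldsymbol s,\delta_0)$ and (A2) $\|\tilde{\boldsymbol F}\|\le\max_{\boldsymbol x\in B(\boldsymbol s,\delta_0)}\|\boldsymbol F(\boldsymbol x)\|=L$ with $0<L<1$. Let $D_0=a$ and $K_1,K_2,K_3,K_3'$ be constants associated with $\delta_0$ as described in the context. Then there exists $\delta\in(0,\delta_0]$ such that the following holds. Suppose RRE is applied in the MC-Mode, with this $n$ and without stopping, starting from (A3) a vector $\boldsymbol s^{(0)}_{n,k_0}:=\boldsymbol x_0\in B(\boldsymbol s,\delta)$; suppose that $\boldsymbol\epsilon^{(r)}_n\ne\boldsymbol 0$ in every cycle $r\ge1$; and suppose that (A4) $\|(\tilde{\boldsymbol W}^{(r)})^{+}\|_2\le\eta/\|\boldsymbol\epsilon^{(r)}_n\|$ in every cycle $r\ge1$. Then $\lim_{r\to\infty}\boldsymbol s^{(r)}_{n,k_r}=\boldsymbol s$, and the convergence is quadratic in the sense that $$\limsup_{r\to\infty}\frac{\|\boldsymbol s^{(r+1)}_{n,k_{r+1}}-\boldsymbol s\|}{\|\boldsymbol s^{(r)}_{n,k_r}-\boldsymbol s\|^2}\le \tau_nL^{2n},$$ where $\tau_n=\lim_{r\to\infty}\tau_n^{(r)}$ and $$\tau_n^{(r)}=\bigl[K_2\eta D_0+(K_1\lambda_n^{(r)}+K_3\eta)(1+L)\bigr]\|\boldsymbol G^{-1}\|_2,\qquad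 \lambda_n^{(r)}=\sqrt2\,\frac{K_3'\eta^2}{1-K_3'\eta\|\boldsymbol\epsilon_n^{(r)}\|}.$$
   Context: Setting: $\boldsymbol f:\mathbb C^N\to\mathbb C^N$, $\boldsymbol s$ is a solution of $\boldsymbol x=\boldsymbol f(\boldsymbol x)$, $\boldsymbol F(\boldsymbol x)$ is the Jacobian matrix of $\boldsymbol f$ at $\boldsymbol x$, $\tilde{\boldsymbol F}=\boldsymbol F(\boldsymbol s)$ with $\rho(\tilde{\boldsymbol F})<1$, and $\boldsymbol G=\boldsymbol I-\tilde{\boldsymbol F}$ (nonsingular). $\|\cdot\|_2$ is the standard $l_2$ vector norm and its induced matrix norm. $\|\boldsymbol z\|=\|\boldsymbol G\boldsymbol z\|_2$ for $\boldsymbol z\in\mathbb C^N$, and for $N\times N$ matrices $\|\boldsymbol A\|=\|\boldsymbol G\boldsymbol A\boldsymbol G^{-1}\|_2$ is the induced norm. $B(\boldsymbol s,\delta)=\{\boldsymbol x:\|\boldsymbol x-\boldsymbol s\|\le\delta\}$. Reduced Rank Extrapolation (RRE): given $\boldsymbol x_0$ and $\boldsymbol x_{m+1}=\boldsymbol f(\boldsymbol x_m)$, with $\boldsymbol u_m=\boldsymbol x_{m+1}-\boldsymbol x_m$, $\boldsymbol w_m=\boldsymbol u_{m+1}-\boldsymbol u_m$, and the $N\times k$ matrices $\boldsymbol U=[\boldsymbol u_n|\cdots|\boldsymbol u_{n+k-1}]$, $\boldsymbol W=[\boldsymbol w_n|\cdots|\boldsymbol w_{n+k-1}]$, the RRE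 approximation is $\boldsymbol s_{n,k}=\boldsymbol x_n-\boldsymbol U\boldsymbol W^{+}\boldsymbol u_n$, where $^{+}$ is the Moore–Penrose inverse. (Equivalently $\boldsymbol s_{n,k}=\sum_{i=0}^k\gamma_i\boldsymbol x_{n+i}$ with the $\gamma_i$ minimizing $\|\sum_{i=0}^k\gamma_i\boldsymbol u_{n+i}\|_2$ subject to $\sum_{i=0}^k\gamma_i=1$.) The minimal polynomial of $\boldsymbol T$ with respect to a nonzero vector $\boldsymbol u$ is the monic polynomial $P$ of smallest degree with $P(\boldsymbol T)\boldsymbol u=\boldsymbol 0$. MC-Mode (cycling with fixed $n$): set $\boldsymbol s^{(0)}_{n,k_0}=\boldsymbol x_0$ (here $k_0$ is only notation). In cycle $r=1,2,\ldots$, put $\boldsymbol x_0^{(r)}=\boldsymbol s^{(r-1)}_{n,k_{r-1}}$, generate $\boldsymbol x^{(r)}_{m+1}=\boldsymbol f(\boldsymbol x^{(r)}_m)$, put $\boldsymbol\epsilon^{(r)}_m=\boldsymbol x^{(r)}_m-\boldsymbol s$, let $k_r$ be the degree of the minimal polynomial of $\tilde{\boldsymbol F}$ with respect to $\boldsymbol\epsilon_n^{(r)}$, and let $\boldsymbol s^{(r)}_{n,k_r}$ be the RRE approximation $\boldsymbol s_{n,k}$ with $k=k_r$ computed from $\boldsymbol x^{(r)}_n,\ldots,\boldsymbol x^{(r)}_{n+k_r+1}$. The matrix $\tilde{\boldsymbol W}^{(r)}$ is the $N\times k_r$ matrix with columns $(\tilde{\boldsymbol F}-\boldsymbol I)^2\tilde{\boldsymbol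 F}^{\,i}\boldsymbol\epsilon^{(r)}_n$, $i=0,\ldots,k_r-1$. Constants: $a>0$ is a constant such that $\|\boldsymbol f(\boldsymbol x)-\boldsymbol s-\tilde{\boldsymbol F}(\boldsymbol x-\boldsymbol s)\|\le a\|\boldsymbol x-\boldsymbol s\|^2$ for all $\boldsymbol x\in B(\boldsymbol s,\delta_0)$, and $D_0=a$. For a sequence $\boldsymbol x_{m+1}=\boldsymbol f(\boldsymbol x_m)$ with $\boldsymbol x_0\in B(\boldsymbol s,\delta_0)$, write $\boldsymbol\epsilon_m=\boldsymbol x_m-\boldsymbol s$, let $\boldsymbol U=[\boldsymbol u_n|\cdots|\boldsymbol u_{n+k-1}]$ and $\boldsymbol W=[\boldsymbol w_n|\cdots|\boldsymbol w_{n+k-1}]$ be the $N\times k$ matrices formed from $\boldsymbol u_m=\boldsymbol x_{m+1}-\boldsymbol x_m$ and $\boldsymbol w_m=\boldsymbol u_{m+1}-\boldsymbol u_m$, let $\tilde{\boldsymbol U},\tilde{\boldsymbol W}$ be the $N\times k$ matrices with columns $(\tilde{\boldsymbol F}-\boldsymbol I)\tilde{\boldsymbol F}^{\,i}\boldsymbol\epsilon_n$ and $(\tilde{\boldsymbol F}-\boldsymbol I)^2\tilde{\boldsymbol F}^{\,i}\boldsymbol\epsilon_n$, $i=0,\ldots,k-1$, respectively, and let $\check{\boldsymbol U}=\boldsymbol U-\tilde{\boldsymbol U}$, $\check{\boldsymbol W}=\boldsymbol W-\tilde{\boldsymbol W}$. Then $K_1,K_2,K_3,K_3'$ denote positive constants,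 independent of $k$, $n$ and of the starting vector $\boldsymbol x_0\in B(\boldsymbol s,\delta_0)$, such that always $$\|\boldsymbol G\boldsymbol U\|_2\le K_1\|\boldsymbol\epsilon_n\|,\quad \|\boldsymbol G\tilde{\boldsymbol U}\|_2\le K_2\|\boldsymbol\epsilon_n\|,\quad \|\boldsymbol G\check{\boldsymbol U}\|_2\le K_3\|\boldsymbol\epsilon_n\|^2,\quad \|\check{\boldsymbol W}\|_2\le K_3'\|\boldsymbol\epsilon_n\|^2 .$$ *)

(* Defs.v *)
From HB Require Import structures.
From mathcomp Require Import all_boot all_order all_algebra.
From mathcomp Require Import complex.
From mathcomp Require Import all_classical all_reals all_analysis.

Set Implicit Arguments.
Unset Strict Implicit.
Unset Printing Implicit Defensive.

Import Order.TTheory GRing.Theory Num.Theory.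
Import numFieldNormedType.Exports.

Local Open Scope classical_set_scope.
Local Open Scope ring_scope.
Local Open Scope sesquilinear_scope.

(* Typing [R[i]] as a numClosedFieldType lets the topology of an abstract
   numFieldType be inferred for it; [R[i]] itself carries no such instance. *)
Definition cplx (R : realType) : numClosedFieldType := R[i].

Section LinearAlgebra.
Variable R : realType.
Local Notation C := (cplx R).

Definition l2norm (m : nat) (v : 'cV[C]_m) : R :=
  Num.sqrt (\sum_i Normc.normc (v i 0) ^+ 2).

Definition opnorm (m p : nat) (A : 'M[C]_(m, p)) : R :=
  sup [set l2norm (A *m v) | v in [set v | l2norm v <= 1]].

Definition spectral_radius (m : nat) (A : 'M[C]_m) : R :=
  sup [set Normc.normc z | z in [set z : C | eigenvalue A z]].

Definition penrose (m p : nat) (A : 'M[C]_(m, p)) (X : 'M[C]_(p, m)) : Prop :=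
  [/\ A *m X *m A = A, X *m A *m X = X,
      (A *m X)^t* = A *m X & (X *m A)^t* = X *m A].

(* This is not mathcomp's [pinvmx], which is only some partial inverse. *)
Definition mppinv (m p : nat) (A : 'M[C]_(m, p)) : 'M[C]_(p, m) :=
  xget 0 [set X | penrose A X].

Lemma mulmx_ctr_eq0 (m p : nat) (A : 'M[C]_(m, p)) : A *m A^t* = 0 -> A = 0.
Proof.
move=> AA0; apply/matrixP => i j; rewrite mxE.
have := congr1 (fun M : 'M[C]_m => M i i) AA0; rewrite !mxE => /eqP.
rewrite psumr_eq0 => [/allP/(_ j (mem_index_enum _))/=|k _]; rewrite !mxE.
  by rewrite -normCK sqrf_eq0 normr_eq0 => /eqP.
by rewrite -normCK exprn_ge0.
Qed.

Lemma gram_unitmx (m p : nat) (A : 'M[C]_(m, p)) :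
  row_free A -> A *m A^t* \in unitmx.
Proof.
move=> Afree; rewrite -row_free_unit -kermx_eq0 -(mulmx_free_eq0 _ Afree).
apply/eqP/mulmx_ctr_eq0.
by rewrite trmx_mul map_mxM /= mulmxA -(mulmxA _ A) mulmx_ker mul0mx.
Qed.

Lemma penrose_uniq (m p : nat) (A : 'M[C]_(m, p)) (X Y : 'M[C]_(p, m)) :
  penrose A X -> penrose A Y -> X = Y.
Proof.
move=> [AXA XAX AX XA] [AYA YAY AY YA].
have eqAXY : A *m X = A *m Y.
  rewrite -AX -{1}AYA -(mulmxA (A *m Y)) trmx_mul map_mxM /= AX AY.
  by rewrite mulmxA AXA.
have eqXAY : X *m A = Y *m A.
  rewrite -XA -{1}AYA -mulmxA (mulmxA X) trmx_mul map_mxM /= XA YA.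
  by rewrite -!mulmxA (mulmxA A) AXA.
by rewrite -XAX -mulmxA eqAXY mulmxA eqXAY YAY.
Qed.

Lemma mppinvP (m p : nat) (A : 'M[C]_(m, p)) : penrose A (mppinv A).
Proof.
apply: (@xgetPex _ 0 [set X | penrose A X]).
have [r [D [B [-> Bfree Dfree]]]] : exists r (D : 'M[C]_(m, r)) B,
    [/\ A = D *m B, row_free B & row_free (D^t*)].
  exists (\rank A), (col_base A), (row_base A).
  split; rewrite ?mulmx_base ?row_base_free //.
  by rewrite /row_free mxrank_map mxrank_tr -/(row_full _) col_base_full.
have GB := gram_unitmx Bfree; have := gram_unitmx Dfree.
rewrite trmxCK => GD.
have ctrV n (M : 'M[C]_n) : M^t* = M -> (invmx M)^t* = invmx M.
  by move=> {2}<-; rewrite trmx_inv map_invmx.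
have ctrG a b (M : 'M[C]_(a, b)) : (M *m M^t*)^t* = M *m M^t*.
  by rewrite trmx_mul map_mxM /= trmxCK.
have GDc : (D^t* *m D)^t* = D^t* *m D.
  by rewrite trmx_mul map_mxM /= trmxCK.
pose X := B^t* *m invmx (B *m B^t*) *m invmx (D^t* *m D) *m D^t*.
have AX : D *m B *m X = D *m invmx (D^t* *m D) *m D^t*.
  by rewrite /X !mulmxA -(mulmxA D B) mulmxK.
have XA : X *m (D *m B) = B^t* *m invmx (B *m B^t*) *m B.
  by rewrite /X mulmxA -(mulmxA _ (D^t*) D) mulmxKV.
exists X; split.
- by rewrite AX mulmxA -(mulmxA _ (D^t*) D) mulmxKV.
- by rewrite XA /X !mulmxA -(mulmxA _ B (B^t*)) mulmxKV.
- by rewrite AX !trmx_mul !map_mxM /= trmxCK ctrV // mulmxA.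
- by rewrite XA !trmx_mul !map_mxM /= trmxCK ctrV // mulmxA.
Qed.

Definition is_minpoly (N : nat) (T : 'M[C]_N.+1) (u : 'cV[C]_N.+1)
    (P : {poly C}) : Prop :=
  [/\ P \is monic, horner_mx T P *m u = 0 &
      forall Q : {poly C}, Q \is monic -> horner_mx T Q *m u = 0 ->
        (size P <= size Q)%N].

End LinearAlgebra.

(* Vectors are columns of length [N.+1], i.e. the dimension is positive. *)
Section Calculus.
Variables (R : realType) (N : nat).
Local Notation C := (cplx R).
Local Notation V := ('cV[C]_N.+1).
Implicit Types (f : V -> V) (s x : V).

Definition unitv (j : 'I_N.+1) : V := delta_mx j 0.

(* Complex Jacobian matrix: entry (i, j) is the partial derivative of the i-th
   component of [f] in the j-th coordinate. *)
Definition jac f x : 'M[C]_N.+1 := \matrix_(i, j) ('D_(unitv j) f x) i 0.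

(* Derivatives are complex and two-sided, so that being twice differentiable
   at a boundary point of [B] requires [f] to be differentiable on a
   neighbourhood of that point. *)
Definition C2_on (B : set V) f : Prop :=
  (forall x, B x -> (\forall y \near x, differentiable f y) /\
                    differentiable (jac f) x) /\
  (forall i j l : 'I_N.+1,
     {within B, continuous
        (fun x => 'D_(unitv l) (fun y => jac f y i j) x : C)}).

Definition Ft f s : 'M[C]_N.+1 := jac f s.
Definition Gmx f s : 'M[C]_N.+1 := 1%:M - Ft f s.
Definition vecnorm f s (z : V) : R := l2norm (Gmx f s *m z).
Definition matnorm f s (A : 'M[C]_N.+1) : R :=
  opnorm (Gmx f s *m A *m invmx (Gmx f s)).
Definition sball f s (d : R) : set V := [set x | vecnorm f s (x - s) <= d].

End Calculus.

Section Extrapolation.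
Variables (R : realType) (N : nat).
Local Notation C := (cplx R).
Local Notation V := ('cV[C]_N.+1).
Variable f : V -> V.
Implicit Types (s x eps : V) (n m k : nat).

Definition xseq x0 m : V := iter m f x0.
Definition useq x0 m : V := xseq x0 m.+1 - xseq x0 m.
Definition wseq x0 m : V := useq x0 m.+1 - useq x0 m.

Definition Umx x0 n k : 'M[C]_(N.+1, k) := \matrix_(i, j) useq x0 (n + j) i 0.
Definition Wmx x0 n k : 'M[C]_(N.+1, k) := \matrix_(i, j) wseq x0 (n + j) i 0.

Definition rre x0 n k : V :=
  xseq x0 n - Umx x0 n k *m (mppinv (Wmx x0 n k) *m useq x0 n).

Definition Utmx s eps k : 'M[C]_(N.+1, k) :=
  \matrix_(i, j) ((Ft f s - 1%:M) *m (Ft f s ^+ j) *m eps) i 0.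
Definition Wtmx s eps k : 'M[C]_(N.+1, k) :=
  \matrix_(i, j) ((Ft f s - 1%:M) ^+ 2 *m (Ft f s ^+ j) *m eps) i 0.

Definition err s x0 m : V := xseq x0 m - s.

Definition RRE_constants s (delta0 K1 K2 K3 K3' : R) : Prop :=
  forall x0 n k, sball f s delta0 x0 ->
    let e := vecnorm f s (err s x0 n) in
    let G := Gmx f s in
    let U := Umx x0 n k in let Ut := Utmx s (err s x0 n) k in
    let W := Wmx x0 n k in let Wt := Wtmx s (err s x0 n) k in
    [/\ opnorm (G *m U) <= K1 * e, opnorm (G *m Ut) <= K2 * e,
        opnorm (G *m (U - Ut)) <= K3 * e ^+ 2 & opnorm (W - Wt) <= K3' * e ^+ 2].

(* [sq r] is the output of cycle [r], and [sq 0] the initial vector; cycle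
   [r >= 1] therefore starts from [sq r.-1]. The value [kq 0] is irrelevant. *)
Definition cycle_err s (sq : nat -> V) n r : V := err s (sq r.-1) n.

Definition MC_mode s x0 n (kq : nat -> nat) (sq : nat -> V) : Prop :=
  sq 0%N = x0 /\
  forall r, (1 <= r)%N ->
    (exists2 P, is_minpoly (Ft f s) (cycle_err s sq n r) P &
                kq r = (size P).-1) /\
    sq r = rre (sq r.-1) n (kq r).

Definition lambda_n s sq n (eta K3' : R) r : R :=
  Num.sqrt 2 * (K3' * eta ^+ 2 /
                (1 - K3' * eta * vecnorm f s (cycle_err s sq n r))).

Definition tau_n s sq n (L eta D0 K1 K2 K3 K3' : R) r : R :=
  (K2 * eta * D0 + (K1 * lambda_n s sq n eta K3' r + K3 * eta) * (1 + L)) *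
  opnorm (invmx (Gmx f s)).

End Extrapolation.

(* Main.v *)
(* Let e = x_n - s in some cycle. Were f affine, the degree of the minimal
   polynomial of F~ with respect to e would make the extrapolation exact:
   e = U~ W~^+ (F~ - I) e. Hence the true error is minus
     U (W^+ - W~^+) u_n + (U - U~) W~^+ u_n + U~ W~^+ (u_n - (F~ - I) e),
   where each term is O(|e|^2): W - W~ is O(|e|^2) while W~^+ is O(1/|e|), so that
   a perturbation bound for pseudo-inverses gives W^+ - W~^+ = O(1).

   No mean value inequality is needed to compare e with the initial error of the
   cycle: by the quadratic bound on the remainder of f, each step contracts by
   L + a |x_0 - s|, and this factor tends to L as the cycles converge. *)
Require Import Defs.
From HB Require Import structures.
From mathcomp Require Import all_boot all_order all_algebra.
From mathcomp Require Import complex.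
From mathcomp Require Import all_classical all_reals all_analysis.
From mathcomp Require Import ring lra.

Set Implicit Arguments.
Unset Strict Implicit.
Unset Printing Implicit Defensive.

Import Order.TTheory GRing.Theory Num.Theory.
Import numFieldNormedType.Exports.
Local Open Scope classical_set_scope.
Local Open Scope ring_scope.

(** * The Euclidean norm and its induced matrix norm *)

Section L2Norm.
Variable R : realType.
Local Open Scope sesquilinear_scope.
Local Notation C := (cplx R).
Local Notation rc := (real_complex R : R -> C).

Lemma l2norm_ge0 m (v : 'cV[C]_m) : 0 <= l2norm v.
Proof. exact: sqrtr_ge0. Qed.

Lemma l2norm_sqrE m (v : 'cV[C]_m) : rc (l2norm v ^+ 2) = (v^t* *m v) 0 0.
Proof.
rewrite sqr_sqrtr; last by apply: sumr_ge0 => i _; rewrite sqr_ge0.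
rewrite rmorph_sum mxE; apply: eq_bigr => i _; rewrite !mxE mulrC -normCK.
by rewrite rmorphXn.
Qed.

(** Transposition carries columns to rows, for which the Hermitian product [dotmx] supplies the
    Cauchy-Schwarz and triangle inequalities. *)
Lemma l2norm_dotmx m (v : 'cV[C]_m) : sqrtC (dotmx v^T v^T) = rc (l2norm v).
Proof.
have -> : dotmx v^T v^T = rc (l2norm v ^+ 2).
  by rewrite l2norm_sqrE dotmxE !mxE; apply: eq_bigr => i _; rewrite !mxE mulrC.
by rewrite rmorphXn sqrCK // -[0]/(rc 0) lecR l2norm_ge0.
Qed.

Lemma l2norm_dot_le m (u v : 'cV[C]_m) :
  `|(v^t* *m u) 0 0| <= rc (l2norm u * l2norm v).
Proof.
have -> : (v^t* *m u) 0 0 = dotmx u^T v^T.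
  by rewrite dotmxE !mxE; apply: eq_bigr => i _; rewrite !mxE mulrC.
by rewrite rmorphM /= -!l2norm_dotmx CauchySchwarz_sqrt.
Qed.

Lemma l2normD m (u v : 'cV[C]_m) : l2norm (u + v) <= l2norm u + l2norm v.
Proof.
rewrite -lecR rmorphD /= -!l2norm_dotmx raddfD /=.
exact: (triangle_lerif _ (u^T) (v^T)).
Qed.

Lemma normc_ge0 (z : C) : 0 <= Normc.normc z.
Proof. by case: z => x y; exact: sqrtr_ge0. Qed.

Lemma l2normZ m (a : C) (v : 'cV[C]_m) :
  l2norm (a *: v) = Normc.normc a * l2norm v.
Proof.
rewrite /l2norm; under eq_bigr do rewrite mxE Normc.normcM exprMn.
by rewrite -mulr_sumr sqrtrM ?sqr_ge0// sqrtr_sqr ger0_norm ?normc_ge0.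
Qed.

Lemma l2normN m (v : 'cV[C]_m) : l2norm (- v) = l2norm v.
Proof. by rewrite -scaleN1r l2normZ normcN Normc.normc1 mul1r. Qed.

Lemma l2norm0 m : l2norm (0 : 'cV[C]_m) = 0.
Proof. by rewrite -(scale0r 0) l2normZ Normc.normc0 mul0r. Qed.

Lemma normc_le_l2norm m (v : 'cV[C]_m) i : Normc.normc (v i 0) <= l2norm v.
Proof.
rewrite -[leLHS]ger0_norm ?normc_ge0// -sqrtr_sqr ler_wsqrtr// (bigD1 i)//= lerDl.
by apply: sumr_ge0 => j _; rewrite sqr_ge0.
Qed.

Lemma l2norm_eq0 m (v : 'cV[C]_m) : l2norm v = 0 -> v = 0.
Proof.
move=> v0; apply/matrixP => i j; rewrite ord1 mxE; apply: Normc.eq0_normc.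
by apply/eqP; rewrite eq_le normc_ge0 -{1}v0 normc_le_l2norm.
Qed.

Lemma l2norm_sqrD m (u v : 'cV[C]_m) : u^t* *m v = 0 ->
  l2norm (u + v) ^+ 2 = l2norm u ^+ 2 + l2norm v ^+ 2.
Proof.
move=> uv; apply: (@complexI R); rewrite rmorphD /= !l2norm_sqrE.
have vu : v^t* *m u = 0.
  by rewrite -(trmxCK u) -map_mxM -trmx_mul uv trmx0 map_mx0.
have -> : (u + v)^t* = u^t* + v^t* by rewrite linearD map_mxD.
by rewrite mulmxDl !mulmxDr uv vu addr0 add0r mxE.
Qed.

(** The supremum in [opnorm] is meaningful: the coordinates of [v] have modulus at most 1, so the
    column norms of [A] add up to a bound. *)
Lemma has_sup_opnorm m p (A : 'M[C]_(m, p)) :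
  has_sup [set l2norm (A *m v) | v in [set v | l2norm v <= 1]].
Proof.
split; first by exists (l2norm (A *m 0)), 0 => //=; rewrite l2norm0.
exists (\sum_j l2norm (col j A)) => _ [v /= v1 <-].
have -> : A *m v = \sum_j v j 0 *: col j A.
  apply/matrixP => i j; rewrite ord1 !mxE summxE; apply: eq_bigr => k _.
  by rewrite !mxE mulrC.
apply: (big_ind2 (fun u t => l2norm u <= t)); first by rewrite l2norm0.
  by move=> u x w y ux wy; rewrite (le_trans (l2normD _ _)) ?lerD.
move=> j _; rewrite l2normZ ler_piMl ?l2norm_ge0//.
exact: le_trans (normc_le_l2norm _ _) v1.
Qed.

Lemma opnormN m p (A : 'M[C]_(m, p)) : opnorm (- A) = opnorm A.
Proof.
congr (sup _); apply/seteqP; split=> _ [v v1 <-];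
  by exists v; [exact: v1|rewrite mulNmx l2normN].
Qed.

Lemma opnorm_ge0 m p (A : 'M[C]_(m, p)) : 0 <= opnorm A.
Proof.
apply: ub_le_sup; first by case: (has_sup_opnorm A).
by exists 0; rewrite /= ?mulmx0 l2norm0.
Qed.

Lemma l2norm_mulmx_le m p (A : 'M[C]_(m, p)) v :
  l2norm (A *m v) <= opnorm A * l2norm v.
Proof.
have [v0|v0] := eqVneq (l2norm v) 0.
  by rewrite (l2norm_eq0 v0) mulmx0 !l2norm0 mulr0.
have vgt0 : 0 < l2norm v by rewrite lt_def v0 l2norm_ge0.
have ncV : Normc.normc (rc (l2norm v)^-1) = (l2norm v)^-1.
  by rewrite /= expr0n addr0 sqrtr_sqr ger0_norm // invr_ge0 ltW.
rewrite -ler_pdivrMr// mulrC -{1}ncV -l2normZ scalemxAr.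
apply: ub_le_sup; first by case: (has_sup_opnorm A).
by eexists => //=; rewrite l2normZ ncV mulVf.
Qed.

Lemma l2norm_mulmx_le_trans {m p} {A : 'M[C]_(m, p)} {v a b} :
  opnorm A <= a -> l2norm v <= b -> l2norm (A *m v) <= a * b.
Proof.
move=> Aa vb; apply: le_trans (l2norm_mulmx_le _ _) _.
by rewrite ler_pM ?opnorm_ge0 ?l2norm_ge0.
Qed.

End L2Norm.

(** * Perturbation of the Moore-Penrose inverse *)

Section PseudoInverse.
Variable R : realType.
Local Open Scope sesquilinear_scope.
Local Notation C := (cplx R).
Variables m p : nat.
Implicit Types A B : 'M[C]_(m, p).

(** The columns of [mppinv A *m A - 1%:M] are killed by [A]. *)
Lemma mppinv_mulmx1 A : (forall c : 'cV_p, A *m c = 0 -> c = 0) ->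
  mppinv A *m A = 1%:M.
Proof.
move=> Ainj; have [AXA _ _ _] := mppinvP A.
apply/eqP; rewrite -subr_eq0; apply/eqP/matrixP => i j.
have /Ainj/matrixP/(_ i 0) : A *m col j (mppinv A *m A - 1%:M) = 0.
  by rewrite colE mulmxA mulmxBr mulmxA AXA mulmx1 subrr mul0mx.
by rewrite !mxE.
Qed.

(** [A *m mppinv A] is Hermitian and fixes [A], hence is the orthogonal projection onto the range of
    [A]. *)
Lemma mppinv_orthogonal A (v : 'cV_m) : A^t* *m (v - A *m mppinv A *m v) = 0.
Proof.
have [AXA _ AX _] := mppinvP A.
rewrite mulmxBr mulmxA -{1}AX -map_mxM -trmx_mul AXA.
by rewrite subrr.
Qed.

Lemma mppinv_pythagoras A (v : 'cV_m) : l2norm v ^+ 2 =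
  l2norm (A *m mppinv A *m v) ^+ 2 + l2norm (v - A *m mppinv A *m v) ^+ 2.
Proof.
rewrite -l2norm_sqrD; first by rewrite addrC subrK.
rewrite -!(mulmxA A) trmx_mul map_mxM /= -mulmxA.
by rewrite (mulmxA A) mppinv_orthogonal mulmx0.
Qed.

Lemma l2norm_range_proj A (v : 'cV_m) : l2norm (A *m mppinv A *m v) <= l2norm v.
Proof.
rewrite -(@ler_pXn2r _ 2) ?nnegrE ?l2norm_ge0//.
by rewrite [leRHS](mppinv_pythagoras A) lerDl sqr_ge0.
Qed.

Section Perturbation.
Variables (A B : 'M[C]_(m, p)) (alpha beta e : R).
Hypothesis AXA1 : mppinv A *m A = 1%:M.
Hypothesis Aalpha : opnorm (mppinv A) <= alpha.
Hypothesis ABe : opnorm (B - A) <= e.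
Hypothesis alphae : alpha * e < 1.
Hypothesis alpha_le : alpha <= beta * (1 - alpha * e).

Let alpha_ge0 : 0 <= alpha. Proof. exact: le_trans (opnorm_ge0 _) Aalpha. Qed.
Let e_ge0 : 0 <= e. Proof. exact: le_trans (opnorm_ge0 _) ABe. Qed.

Let beta_ge0 : 0 <= beta.
Proof. by rewrite -(@pmulr_lge0 _ (1 - alpha * e)) ?subr_gt0// (le_trans _ alpha_le). Qed.

Let alpha_le_beta : alpha <= beta.
Proof. by apply: le_trans alpha_le _; rewrite ler_piMr// gerBl mulr_ge0. Qed.

(** Since [mppinv A] is a left inverse, |c| <= alpha |A c| <= alpha (|B c| + e |c|), and the last
    term is absorbed on the left. Thus [beta] stands for any number at least
    [alpha / (1 - alpha * e)]. *)
Lemma perturb_lower_bound c : l2norm c <= beta * l2norm (B *m c).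
Proof.
have cA : l2norm c <= alpha * l2norm (A *m c).
  rewrite -{1}[c]mul1mx -AXA1 -mulmxA.
  exact: l2norm_mulmx_le_trans.
have AB : l2norm (A *m c) <= l2norm (B *m c) + e * l2norm c.
  have -> : A *m c = B *m c + - ((B - A) *m c).
    by rewrite mulmxBl opprB addrC subrK.
  apply: le_trans (l2normD _ _) _; rewrite lerD2l l2normN.
  exact: l2norm_mulmx_le_trans.
have ae : 0 < 1 - alpha * e by rewrite subr_gt0.
move: (l2norm c) (l2norm (A *m c)) (l2norm (B *m c)) (l2norm_ge0 (B *m c)) cA AB.
move=> x y z z0 xy yz.
rewrite -(ler_pM2r ae); have := ler_wpM2l alpha_ge0 yz.
have := ler_wpM2r z0 alpha_le; lra.
Qed.

Lemma perturb_mppinv_mulmx1 : mppinv B *m B = 1%:M.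
Proof.
apply: mppinv_mulmx1 => c Bc0; apply: l2norm_eq0; apply/eqP.
by rewrite eq_le l2norm_ge0 andbT (le_trans (perturb_lower_bound c))//
  Bc0 l2norm0 mulr0.
Qed.

Lemma perturb_mppinv_le w : l2norm (mppinv B *m w) <= beta * l2norm w.
Proof.
apply: le_trans (perturb_lower_bound _) _.
by rewrite mulmxA ler_wpM2l// l2norm_range_proj.
Qed.

(** For c = B^+ y, the residual y - B c is orthogonal to the range of B and y to that of A, so |B
    c|^2 = <(B - A) c, y> <= e |c| |y|. With |c| <= beta |B c|, one factor |c| cancels. *)
Lemma perturb_mppinv_orthogonal y : A^t* *m y = 0 ->
  l2norm (mppinv B *m y) <= beta ^+ 2 * e * l2norm y.
Proof.
move=> Ay; set c := mppinv B *m y.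
have cB := perturb_lower_bound c.
have BcE : (B *m c)^t* *m (B *m c) = ((B - A) *m c)^t* *m y.
  have adj0 M (z : 'cV_m) : M^t* *m z = 0 -> (M *m c)^t* *m z = 0.
    by move=> Mz; rewrite trmx_mul map_mxM -mulmxA Mz mulmx0.
  have ctrB (u v : 'cV[C]_m) : (u - v)^t* = u^t* - v^t*.
    by apply/matrixP => i j; rewrite !mxE rmorphB.
  rewrite [(B - A) *m c]mulmxBl ctrB [RHS]mulmxBl (adj0 A y Ay) subr0.
  apply/esym/eqP; rewrite -subr_eq0 -mulmxBr; apply/eqP/adj0.
  by rewrite /c mulmxA mppinv_orthogonal.
have Bc : l2norm (B *m c) ^+ 2 <= l2norm y * (e * l2norm c).
  have : real_complex R (l2norm (B *m c) ^+ 2) <=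
      real_complex R (l2norm y * l2norm ((B - A) *m c)) :> C.
    rewrite l2norm_sqrE BcE; apply: le_trans (l2norm_dot_le _ _).
    rewrite real_ler_norm// -BcE -l2norm_sqrE.
    by apply: ger0_real; rewrite ler0c sqr_ge0.
  rewrite lecR => /le_trans; apply; rewrite ler_wpM2l ?l2norm_ge0//.
  exact: l2norm_mulmx_le_trans.
have [->|c0] := eqVneq (l2norm c) 0.
  by rewrite mulr_ge0 ?l2norm_ge0// mulr_ge0// exprn_ge0.
have cgt0 : 0 < l2norm c by rewrite lt_def c0 l2norm_ge0.
rewrite -(ler_pM2r cgt0) -expr2.
have c2 : l2norm c ^+ 2 <= (beta * l2norm (B *m c)) ^+ 2.
  have bB0 : 0 <= beta * l2norm (B *m c) by exact: le_trans (l2norm_ge0 _) cB.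
  by rewrite lerXn2r// nnegrE l2norm_ge0.
apply: le_trans c2 _; rewrite exprMn.
have -> : beta ^+ 2 * e * l2norm y * l2norm c =
    beta ^+ 2 * (l2norm y * (e * l2norm c)) by ring.
by rewrite ler_wpM2l// exprn_ge0.
Qed.

(* The classical bound for full-rank matrices has [alpha * beta] in place of
   [beta ^+ 2] and needs equality of the gaps between the two ranges; both
   bounds agree to first order in [e]. *)
Lemma mppinv_perturb v : l2norm ((mppinv B - mppinv A) *m v) <=
  Num.sqrt 2 * (beta ^+ 2 * e) * l2norm v.
Proof.
have [_ XAX _ _] := mppinvP A.
set Pv := A *m mppinv A *m v; set y := v - Pv.
(* As B^+ B = I, the difference splits according to v = Pv + y, the parts of [v] in the range of [A]
   and orthogonal to it. *)
have BA : mppinv B *m (A - B) *m mppinv A *m v =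
    mppinv B *m Pv - mppinv A *m v.
  by rewrite mulmxBr perturb_mppinv_mulmx1 mulmxBl mul1mx mulmxBl /Pv !mulmxA.
have -> : (mppinv B - mppinv A) *m v =
    mppinv B *m (A - B) *m mppinv A *m v + mppinv B *m y.
  by rewrite BA mulmxBl /y mulmxBr [RHS]addrC addrA subrK.
have h1 : l2norm (mppinv B *m (A - B) *m mppinv A *m v) <=
    beta ^+ 2 * e * l2norm Pv.
  rewrite -!mulmxA.
  (* Keeping |Pv| rather than |v| lets Pythagoras combine both bounds. *)
  have -> : mppinv A *m v = mppinv A *m Pv by rewrite /Pv !mulmxA XAX.
  have -> : beta ^+ 2 * e * l2norm Pv = beta * (e * (beta * l2norm Pv)) by ring.
  apply: le_trans (perturb_mppinv_le _) _.
  rewrite ler_wpM2l//.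
  apply: l2norm_mulmx_le_trans; first by rewrite -opprB opnormN.
  apply: l2norm_mulmx_le_trans => //; exact: le_trans Aalpha _.
have h2 : l2norm (mppinv B *m y) <= beta ^+ 2 * e * l2norm y.
  exact: perturb_mppinv_orthogonal (mppinv_orthogonal A v).
apply: le_trans (l2normD _ _) _; apply: le_trans (lerD h1 h2) _.
(* The factor sqrt 2 comes from (p + q)^2 <= 2 (p^2 + q^2) for p = |Pv| and q = |y|. *)
rewrite -mulrDr [Num.sqrt 2 * _]mulrC -[leRHS]mulrA.
rewrite ler_wpM2l ?mulr_ge0 ?exprn_ge0//.
rewrite -[leLHS]ger0_norm ?addr_ge0 ?l2norm_ge0// -sqrtr_sqr.
rewrite -[l2norm v]ger0_norm ?l2norm_ge0// -sqrtr_sqr -sqrtrM//.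
rewrite ler_wsqrtr// (mppinv_pythagoras A v) -/Pv -/y.
have := sqr_ge0 (l2norm Pv - l2norm y); nra.
Qed.

End Perturbation.
End PseudoInverse.

(** * Krylov matrices and minimal polynomials *)

Section Krylov.
Variables (R : realType) (N : nat).
Local Notation C := (cplx R).
Variables (F : 'M[C]_N.+1) (u : 'cV[C]_N.+1).

(** Reading [c] as the coefficients of a polynomial of degree below [k] turns questions on Krylov
    matrices into questions on polynomials in [F]. *)
Lemma krylov_mulmx (X : 'M[C]_N.+1) k (c : 'cV[C]_k) :
  (\matrix_(i < N.+1, j < k) (X *m (F ^+ j) *m u) i 0) *m c =
  X *m horner_mx F (rVpoly c^T) *m u.
Proof.
have -> : rVpoly c^T = \sum_(j < k) c j 0 *: 'X^j.
  by rewrite /rVpoly poly_def; apply: eq_bigr => j _; rewrite valK mxE.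
rewrite raddf_sum /= mulmx_sumr mulmx_suml.
apply/matrixP => i l; rewrite ord1 !mxE summxE; apply: eq_bigr => j _.
rewrite linearZ /= rmorphXn /= horner_mx_X -scalemxAr -scalemxAl.
by rewrite !mxE mulrC.
Qed.

Variable P : {poly C}.
Hypothesis minP : is_minpoly F u P.

(** A nonzero [Q], divided by its leading coefficient, would contradict the minimality of [P]. *)
Lemma minpoly_annihil (Q : {poly C}) :
  horner_mx F Q *m u = 0 -> (size Q < size P)%N -> Q = 0.
Proof.
case: minP => _ _ Pmin Qu QP; apply/eqP/negPn/negP => Q0.
have := Pmin ((lead_coef Q)^-1 *: Q); rewrite size_scale ?invr_eq0 ?lead_coef_eq0//.
rewrite leqNgt QP => H; have // : false; apply: H.
  by rewrite monicE lead_coefZ mulVf ?lead_coef_eq0.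
by rewrite linearZ /= -scalemxAl Qu scaler0.
Qed.

Lemma krylov_mulmx_inj (X : 'M[C]_N.+1) (c : 'cV[C]_(size P).-1) :
  X \in unitmx ->
  (\matrix_(i < N.+1, j < (size P).-1) (X *m (F ^+ j) *m u) i 0) *m c = 0 -> c = 0.
Proof.
move=> Xu; rewrite krylov_mulmx -mulmxA => /(congr1 (mulmx (invmx X))).
rewrite mulKmx// mulmx0 => /minpoly_annihil c0.
have P0 : (0 < size P)%N by case: minP => Pm _ _; rewrite size_poly_gt0 monic_neq0.
have /c0 : (size (rVpoly c^T) < size P)%N.
  by rewrite -[ltnRHS](prednK P0) ltnS size_poly.
move=> h; apply: trmx_inj; apply: (can_inj (@rVpolyK _ _)).
by rewrite h trmx0 linear0.
Qed.

(* Writing [P - P(1) = ('X - 1) Q] expresses [u] as [- P(1)^-1 (F - 1) Q(F) u]. *)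
Lemma krylov_reproduce : F - 1%:M \in unitmx ->
  exists c : 'cV[C]_(size P).-1, u =
    (\matrix_(i < N.+1, j < (size P).-1) ((F - 1%:M) *m (F ^+ j) *m u) i 0) *m c.
Proof.
move=> F1; have [Pm Pu _] := minP.
have hX1 Q : horner_mx F (Q * ('X - 1%:P)) = (F - 1%:M) *m horner_mx F Q.
  by rewrite mulrC rmorphM rmorphB /= horner_mx_X horner_mx_C.
have sX1 (Q : {poly C}) : (size (Q * ('X - 1%:P))).-1 = size Q.
  have [->|Q0] := eqVneq Q 0; first by rewrite mul0r size_poly0.
  by rewrite size_Mmonic ?monicXsubC// size_XsubC addn2.
(* If P(1) were 0, the factor X - 1 could be cancelled, as [F - 1%:M] is invertible, leaving a
   shorter annihilator of [u]. *)
have P1 : P.[1] != 0.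
  apply/negP => /factor_theorem[Q PE].
  have Q0 : Q != 0.
    by apply: contraTneq Pm => Q0; rewrite PE Q0 mul0r monicE lead_coef0 eq_sym oner_eq0.
  move/eqP: Q0; apply; apply: minpoly_annihil.
    move: Pu; rewrite PE hX1 -mulmxA => /(congr1 (mulmx (invmx (F - 1%:M)))).
    by rewrite mulKmx// mulmx0.
  have P0 : (0 < size P)%N by rewrite size_poly_gt0 monic_neq0.
  by rewrite -(sX1 Q) -PE ltn_predL.
have /factor_theorem[Q QE] : root (P - P.[1]%:P) 1.
  by rewrite /root !hornerE subrr.
have sQ : (size Q <= (size P).-1)%N.
  rewrite -(sX1 Q) -QE -!subn1 leq_sub2r// (leq_trans (size_polyD _ _))// geq_max leqnn.
  by rewrite size_polyN (leq_trans (size_polyC_leq1 _))// size_poly_gt0 monic_neq0.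
exists (poly_rV (- P.[1]^-1 *: Q))^T; rewrite krylov_mulmx trmxK poly_rV_K; last first.
  by rewrite (leq_trans (size_scale_leq _ _)).
rewrite linearZ /= -scalemxAr -scalemxAl -hX1 -QE rmorphB /= mulmxBl Pu.
by rewrite horner_mx_C mul_scalar_mx sub0r scalerN scaleNr opprK scalerA mulVf// scale1r.
Qed.

(* RRE of order [deg P] has no error on the linearised iteration. *)
Lemma krylov_pinv_exact : F - 1%:M \in unitmx ->
  let U := \matrix_(i < N.+1, j < (size P).-1) ((F - 1%:M) *m (F ^+ j) *m u) i 0 in
  let W := \matrix_(i < N.+1, j < (size P).-1) ((F - 1%:M) ^+ 2 *m (F ^+ j) *m u) i 0 in
  mppinv W *m W = 1%:M /\ U *m (mppinv W *m ((F - 1%:M) *m u)) = u.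
Proof.
move=> F1 U W.
have W1 : mppinv W *m W = 1%:M.
  apply: mppinv_mulmx1 => c; apply: krylov_mulmx_inj.
  by rewrite expr2 unitmx_mul F1.
split=> //; have [c uE] := krylov_reproduce F1.
have UcE : U *m c = _ := krylov_mulmx _ _.
have WcE : W *m c = _ := krylov_mulmx _ _.
have Uc : u = U *m c by [].
clearbody U W.
(* The columns of [W] are those of [U] multiplied by [F - 1%:M], so [mppinv W] recovers the
   coefficients [c] of [u] from [(F - 1%:M) *m u]. *)
have Wc : (F - 1%:M) *m u = W *m c.
  have F1sq : (F - 1%:M) ^+ 2 = (F - 1%:M) *m (F - 1%:M) by exact: expr2.
  by rewrite {1}Uc UcE WcE F1sq !mulmxA.
by rewrite Wc (mulmxA (mppinv W)) W1 mul1mx -Uc.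
Qed.

End Krylov.

(** * Spectral radius below one and invertibility *)

Section SpectralRadius.
Variables (R : realType) (N : nat).
Local Notation C := (cplx R).

(** Otherwise 1 would be an eigenvalue of [A]. *)
Lemma unitmx_spectral_radius (A : 'M[C]_N.+1) :
  spectral_radius A < 1 -> 1%:M - A \in unitmx.
Proof.
move=> rhoA; apply: contraLR rhoA => A1; rewrite -leNgt.
apply: ub_le_sup.
  (* The supremum needs an upper bound; the transpose appears because [eigenvalue] refers to row
     vectors. *)
  exists (opnorm A^T) => _ [z /= /eigenvalueP[v vA v0] <-].
  have : Normc.normc z * l2norm v^T <= opnorm A^T * l2norm v^T.
    by rewrite -l2normZ -linearZ /= -vA trmx_mul l2norm_mulmx_le.
  rewrite ler_pM2r// lt_def l2norm_ge0 andbT.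
  by apply: contra v0 => /eqP/l2norm_eq0/(congr1 trmx); rewrite trmxK trmx0 => ->.
exists 1; rewrite ?Normc.normc1//= /eigenvalue /eigenspace kermx_eq0.
by rewrite row_free_unit -opprB -scaleN1r unitmxZ// unitrN1.
Qed.

End SpectralRadius.

(** The product [U *m (X *m u)] passes to [Ut *m (Xt *m ut)] by replacing [X], then [U], then
    [u]. *)
Lemma mulmx_perturb_eq (K : pzRingType) m k (U Ut : 'M[K]_(m, k))
    (X Xt : 'M[K]_(k, m)) (u ut e : 'cV[K]_m) : e = Ut *m (Xt *m ut) ->
  e - U *m (X *m u) = - (U *m ((X - Xt) *m u) + (U - Ut) *m (Xt *m u) +
                         Ut *m (Xt *m (u - ut))).
Proof.
move=> ->; rewrite !(mulmxBl, mulmxBr).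
by rewrite !subrKA opprB.
Qed.

(** * Errors along the fixed-point iteration *)

Section Cycle.
Variables (R : realType) (N : nat).
Local Notation C := (cplx R).
Local Notation V := 'cV[C]_N.+1.
Variables (f : V -> V) (s : V).
Local Notation F := (Ft f s).
Local Notation G := (Gmx f s).
Local Notation vnorm := (vecnorm f s).

Lemma vecnorm_ge0 z : 0 <= vnorm z.
Proof. exact: l2norm_ge0. Qed.

Lemma vecnormD u v : vnorm (u + v) <= vnorm u + vnorm v.
Proof. by rewrite /vecnorm mulmxDr l2normD. Qed.

Lemma vecnormN u : vnorm (- u) = vnorm u.
Proof. by rewrite /vecnorm mulmxN l2normN. Qed.

Lemma vecnorm_mulmx_le p (A : 'M[C]_(N.+1, p)) v b c :
  opnorm (G *m A) <= b -> l2norm v <= c -> vnorm (A *m v) <= b * c.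
Proof. by rewrite /vecnorm mulmxA; exact: l2norm_mulmx_le_trans. Qed.

Section Contraction.
Hypothesis Gunit : G \in unitmx.

(** This change of norm is the source of the factor |G^-1| in the rate. *)
Lemma l2norm_le_vecnorm z : l2norm z <= opnorm (invmx G) * vnorm z.
Proof. by rewrite -{1}(mulKmx Gunit z) l2norm_mulmx_le. Qed.

Lemma vecnorm_gt0 z : z != 0 -> 0 < vnorm z.
Proof.
move=> z0; rewrite lt_def vecnorm_ge0 andbT; apply: contra z0 => /eqP Gz.
by rewrite -(mulKmx Gunit z) (l2norm_eq0 Gz) mulmx0.
Qed.

Variables (delta0 a L : R).
Hypothesis FL : matnorm f s F <= L.
Hypothesis a_ge0 : 0 <= a.
Hypothesis f_quad : forall x, sball f s delta0 x ->
  vnorm (f x - s - F *m (x - s)) <= a * vnorm (x - s) ^+ 2.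

(** Conjugation by [G] turns the linear part into the matrix measured by [matnorm f s F]; the
    remainder is quadratic. *)
Lemma vecnorm_step_le x : sball f s delta0 x ->
  vnorm (f x - s) <= (L + a * vnorm (x - s)) * vnorm (x - s).
Proof.
move=> xB; rewrite -(subrK (F *m (x - s)) (f x - s)).
apply: le_trans (vecnormD _ _) _; rewrite mulrDl addrC -mulrA -expr2.
apply: lerD (f_quad xB); rewrite {1}/vecnorm.
have -> : G *m (F *m (x - s)) = G *m F *m invmx G *m (G *m (x - s)).
  by rewrite -!mulmxA mulKmx.
exact: l2norm_mulmx_le_trans.
Qed.

Variable x0 : V.
Let v := vnorm (x0 - s).
Hypothesis x0B : v <= delta0.
Hypothesis q1 : L + a * v <= 1.
Hypothesis L_ge0 : 0 <= L.

(** Membership in the ball is carried through the induction because the remainder bound holds only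
    there. The errors never exceed [v], so the factor [L + a * v] serves every step. *)
Lemma vecnorm_err_le m : vnorm (err f s x0 m) <= (L + a * v) ^+ m * v /\
  sball f s delta0 (xseq f x0 m).
Proof.
have v0 : 0 <= v by exact: vecnorm_ge0.
have q0 : 0 <= L + a * v by rewrite addr_ge0 ?mulr_ge0.
elim: m => [|m [IHe IHB]]; first by rewrite expr0 mul1r.
have ev : vnorm (err f s x0 m) <= v.
  by apply: le_trans IHe _; rewrite ler_piMl ?exprn_ile1.
have eS : vnorm (err f s x0 m.+1) <= (L + a * v) ^+ m.+1 * v.
  apply: le_trans (vecnorm_step_le IHB) _; rewrite exprS -mulrA.
  by rewrite ler_pM ?vecnorm_ge0 ?addr_ge0 ?mulr_ge0 ?vecnorm_ge0 ?lerD2l ?ler_wpM2l.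
split; first exact: eS.
rewrite /sball /=; apply: le_trans (le_trans eS _) x0B.
by rewrite ler_piMl ?exprn_ile1.
Qed.

End Contraction.

End Cycle.

(* [tau_n] as a function of the initial error [t] of the cycle, except that
   [L + a * t] is the contraction factor used in place of [L] and that the
   denominator of [lambda_n] is squared; neither matters in the limit [t = 0]. *)
Definition rre_rate (R : realType) (eta a L K1 K2 K3 K3' g t : R) : R :=
  (K2 * eta * a + (K1 * (Num.sqrt 2 * (K3' * eta ^+ 2 / (1 - K3' * eta * t) ^+ 2))
     + K3 * eta) * (1 + (L + a * t))) * g.

(** * Bounds and limit of the rate *)

Section Rate.
Variables (R : realType) (eta a L K1 K2 K3 K3' g : R).
Hypotheses (eta_ge0 : 0 <= eta) (a_ge0 : 0 <= a) (L_ge0 : 0 <= L) (g_ge0 : 0 <= g).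
Hypotheses (K1_ge0 : 0 <= K1) (K2_ge0 : 0 <= K2) (K3_ge0 : 0 <= K3) (K3'_ge0 : 0 <= K3').
Local Notation rate := (rre_rate eta a L K1 K2 K3 K3' g).

Lemma rre_rate_ge0 t : 0 <= t -> 0 <= rate t.
Proof.
move=> t0; apply: mulr_ge0 => //; apply: addr_ge0; first by rewrite !mulr_ge0.
apply: mulr_ge0; last by rewrite !addr_ge0 ?mulr_ge0.
apply: addr_ge0; last exact: mulr_ge0.
apply: mulr_ge0 => //; apply: mulr_ge0; first exact: sqrtr_ge0.
by rewrite divr_ge0 ?sqr_ge0// mulr_ge0 ?sqr_ge0.
Qed.

(** The denominator is the square of a number at least 1/2, whence the 4; the contraction factor is
    at most 1, whence the 2. *)
Lemma rre_rate_le t : 0 <= t -> K3' * eta * t <= 2^-1 -> L + a * t <= 1 ->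
  rate t <= (K2 * eta * a +
    (K1 * (Num.sqrt 2 * (K3' * eta ^+ 2 * 4)) + K3 * eta) * 2) * g.
Proof.
move=> t0 kt qt; apply: ler_wpM2r => //; rewrite lerD2l.
have l0 : 0 <= K3' * eta ^+ 2 by rewrite mulr_ge0 ?exprn_ge0.
have D2 : 2^-1 <= 1 - K3' * eta * t by lra.
have D4 : ((1 - K3' * eta * t) ^+ 2)^-1 <= 4.
  rewrite -[leRHS]invrK lef_pV2 ?posrE ?exprn_gt0 ?invr_gt0//; last by lra.
  by nra.
apply: ler_pM.
- apply: addr_ge0; last exact: mulr_ge0.
  by rewrite !mulr_ge0 ?sqrtr_ge0// invr_ge0 sqr_ge0.
- by rewrite !addr_ge0 ?mulr_ge0.
- rewrite lerD2r; apply: ler_wpM2l => //; apply: ler_wpM2l; first exact: sqrtr_ge0.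
  exact: ler_wpM2l.
- by lra.
Qed.

Lemma cvg_rre_rate (u : R ^nat) : u @ \oo --> 0 ->
  (rate \o u) @ \oo --> rate 0.
Proof.
move=> u0; rewrite /rre_rate.
apply: cvgM; last exact: cvg_cst.
apply: cvgD; first exact: cvg_cst.
apply: cvgM; last first.
  apply: cvgD; first exact: cvg_cst.
  by apply: cvgD; [exact: cvg_cst|apply: cvgM => //; exact: cvg_cst].
apply: cvgD; last exact: cvg_cst.
apply: cvgM; first exact: cvg_cst.
apply: cvgM; first exact: cvg_cst.
apply: cvgM; first exact: cvg_cst.
apply: cvgV; first by rewrite mulr0 subr0 expr1n oner_neq0.
apply: cvgM; apply: cvgB; try exact: cvg_cst.
all: by apply: cvgM => //; exact: cvg_cst.
Qed.

End Rate.

(** * Error of one extrapolation cycle *)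

Section CycleEstimate.
Variables (R : realType) (N : nat).
Local Notation C := (cplx R).
Local Notation V := 'cV[C]_N.+1.
Variables (f : V -> V) (s : V) (n : nat) (eta delta0 a L K1 K2 K3 K3' : R).
Local Notation F := (Ft f s).
Local Notation G := (Gmx f s).
Local Notation vnorm := (vecnorm f s).
Hypothesis Gunit : G \in unitmx.
Hypothesis FL : matnorm f s F <= L.
Hypotheses (eta_gt0 : 0 < eta) (a_gt0 : 0 < a) (L_ge0 : 0 <= L).
Hypotheses (K1_gt0 : 0 < K1) (K2_gt0 : 0 < K2) (K3_gt0 : 0 < K3) (K3'_gt0 : 0 < K3').
Hypothesis f_quad : forall x, sball f s delta0 x ->
  vnorm (f x - s - F *m (x - s)) <= a * vnorm (x - s) ^+ 2.
Hypothesis HK : RRE_constants f s delta0 K1 K2 K3 K3'.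
Local Notation g := (opnorm (invmx G)).

Variables (x0 : V) (P : {poly C}).
Let v := vnorm (x0 - s).
Local Notation eps := (err f s x0 n).
Local Notation k := (size P).-1.
Hypothesis x0B : v <= delta0.
Hypothesis q1 : L + a * v <= 1.
Hypothesis kappa1 : K3' * eta * v < 1.
Hypothesis minP : is_minpoly F eps P.
Hypothesis eps0 : eps != 0.
Hypothesis stable : opnorm (mppinv (Wtmx f s eps k)) <= eta / vnorm eps.

Lemma rre_cycle_le : vnorm (rre f x0 n k - s) <=
  rre_rate eta a L K1 K2 K3 K3' g v * vnorm eps ^+ 2.
Proof.
have [eps_le xnB] := vecnorm_err_le Gunit FL (ltW a_gt0) f_quad x0B q1 L_ge0 n.
have e_gt0 : 0 < vnorm eps by exact: vecnorm_gt0.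
have [GU GUt GUU WW] := HK n k x0B.
have v0 : 0 <= v by exact: vecnorm_ge0.
have g0 : 0 <= g by exact: opnorm_ge0.
have q0 : 0 <= L + a * v by rewrite addr_ge0 ?mulr_ge0// ltW.
have ev : vnorm eps <= v.
  by apply: le_trans eps_le _; rewrite ler_piMl ?exprn_ile1.
have FG : F - 1%:M \in unitmx.
  by rewrite -opprB -scaleN1r unitmxZ// unitrN1.
rewrite /rre addrAC -/eps; have st := stable.
have [W1 epsE] : mppinv (Wtmx f s eps k) *m Wtmx f s eps k = 1%:M /\
    Utmx f s eps k *m (mppinv (Wtmx f s eps k) *m ((F - 1%:M) *m eps)) = eps.
  exact: krylov_pinv_exact minP FG.
set U := Umx f x0 n k in GU GUU *; set Ut := Utmx f s eps k in GUt GUU epsE *.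
set W := Wmx f x0 n k in WW *; set Wt := Wtmx f s eps k in WW W1 epsE st *.
set u := useq f x0 n; set ut := (F - 1%:M) *m eps in epsE *.
set e := vnorm eps in st GU GUt GUU WW ev e_gt0 eps_le *.
(* The remainder of [f] at x_n is the deviation of u_n from its linearisation. *)
have xS : f (xseq f x0 n) - s - F *m eps = u - ut.
  rewrite /u /ut /useq /err mulmxBl mul1mx [in RHS]opprB.
  by rewrite addrA addrA subrK.
have uut : l2norm (u - ut) <= g * (a * e ^+ 2).
  rewrite -xS; apply: le_trans (l2norm_le_vecnorm Gunit _) _.
  exact: ler_wpM2l g0 _ _ (f_quad xnB).
(* u_n is the difference of two consecutive errors, whence the factor [1 + (L + a * v)]. *)
have ule : l2norm u <= g * ((1 + (L + a * v)) * e).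
  apply: le_trans (l2norm_le_vecnorm Gunit _) _; apply: (ler_wpM2l g0).
  have -> : u = (f (xseq f x0 n) - s) + - eps.
    by rewrite /u /useq /err opprB addrA subrK.
  apply: le_trans (vecnormD _ _ _ _) _; rewrite vecnormN addrC mulrDl mul1r; apply: lerD (lexx _) _.
  apply: le_trans (vecnorm_step_le Gunit FL f_quad xnB) _.
  have eE : vnorm (xseq f x0 n - s) = e by [].
  rewrite eE; apply: (ler_wpM2r (ltW e_gt0)); rewrite lerD2l.
  exact: (ler_wpM2l (ltW a_gt0) ev).
clearbody e ut Ut Wt U W u.
have D0 : 0 < 1 - K3' * eta * v by rewrite subr_gt0.
have kappaE : eta / e * (K3' * e ^+ 2) = K3' * eta * e.
  by rewrite expr2; field; rewrite gt_eqF.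
have kappa_le : K3' * eta * e <= K3' * eta * v.
  by apply: (ler_wpM2l _ ev); rewrite mulr_ge0 ?ltW.
(* [beta] has [v] in its denominator, which is admissible since [e <= v]; the final rate then
   depends on the initial error of the cycle alone. *)
have pert := @mppinv_perturb R _ _ Wt W (eta / e)
  (eta / e / (1 - K3' * eta * v)) (K3' * e ^+ 2) W1 st WW.
rewrite kappaE in pert.
have {}pert : l2norm ((mppinv W - mppinv Wt) *m u) <=
    Num.sqrt 2 * (K3' * eta ^+ 2 / (1 - K3' * eta * v) ^+ 2) *
      (g * ((1 + (L + a * v)) * e)).
  apply: le_trans (pert _ _ u) _.
  - exact: le_lt_trans kappa1.
  - rewrite mulrAC ler_pdivlMr//; apply: ler_wpM2l.
      by rewrite divr_ge0 ?ltW.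
    by rewrite lerD2l lerN2.
  (* The powers of [e] cancel, so the change of the pseudo-inverse stays bounded. *)
  have -> : (eta / e / (1 - K3' * eta * v)) ^+ 2 * (K3' * e ^+ 2) =
      K3' * eta ^+ 2 / (1 - K3' * eta * v) ^+ 2.
    by field; rewrite !gt_eqF.
  apply: (ler_wpM2l _ ule).
  by rewrite mulr_ge0 ?sqrtr_ge0// divr_ge0 ?mulr_ge0 ?exprn_ge0// ltW.
rewrite (mulmx_perturb_eq _ _ _ (esym epsE)) vecnormN.
apply: le_trans (vecnormD _ _ _ _) _.
apply: le_trans (lerD (vecnormD _ _ _ _) (lexx _)) _.
have t1 := vecnorm_mulmx_le GU pert.
have t2 := vecnorm_mulmx_le GUU (l2norm_mulmx_le_trans st ule).
have t3 := vecnorm_mulmx_le GUt (l2norm_mulmx_le_trans st uut).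
apply: le_trans (lerD (lerD t1 t2) t3) _.
rewrite le_eqVlt; apply/orP; left; apply/eqP; rewrite /rre_rate.
move: (Num.sqrt 2) => r2.
by field; rewrite !gt_eqF.
Qed.

(** The decay of the error over the first [n] steps enters squared, whence the exponent [2 * n]. *)
Lemma rre_cycle_quadratic : vnorm (rre f x0 n k - s) <=
  rre_rate eta a L K1 K2 K3 K3' g v * (L + a * v) ^+ (2 * n) * v ^+ 2.
Proof.
have [eps_le _] := vecnorm_err_le Gunit FL (ltW a_gt0) f_quad x0B q1 L_ge0 n.
have v0 : 0 <= v by exact: vecnorm_ge0.
have q0 : 0 <= L + a * v by rewrite addr_ge0 ?mulr_ge0// ltW.
apply: le_trans rre_cycle_le _; rewrite -mulrA; apply: ler_wpM2l.
  by apply: rre_rate_ge0; first [assumption|exact: ltW|exact: opnorm_ge0].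
move: (vnorm eps) (vecnorm_ge0 f s eps) eps_le q0 v0; rewrite -/v.
move: (v) => w e e0 ew q0 w0; rewrite mulnC exprM -exprMn.
by rewrite lerXn2r// nnegrE mulr_ge0 ?exprn_ge0.
Qed.

End CycleEstimate.

(** * Limits of sequences *)

Lemma cvg_l2norm (R : realType) m (u : nat -> 'cV[cplx R]_m.+1) s :
  (fun r => l2norm (u r - s)) @ \oo --> 0 -> u @ \oo --> s.
Proof.
move=> us; apply/cvg_ballP => e e0.
(* Radii of balls are complex numbers here; a positive one is real. *)
have /complex_realP[d eE] : (e : R[i]) \is Num.real by exact: gtr0_real.
have d0 : 0 < d by move: e0; rewrite eE -[0]/(real_complex R 0) ltcR.
have /cvgrPdist_lt/(_ d d0) := us; apply: filterS => r.
rewrite sub0r normrN ger0_norm ?l2norm_ge0// => ud; split=> [|i j]; first exact: e0.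
rewrite -ball_normE /= distrC eE ord1.
rewrite -[`|_|]/(real_complex R (Normc.normc _)) ltcR; apply: le_lt_trans ud.
by apply: le_trans (normc_le_l2norm _ i); rewrite !mxE.
Qed.

(** Suprema over tails are monotone, and those of [b] converge to [l]. *)
Lemma limn_esup_le_lim (R : realType) (u b : R ^nat) l :
  (forall r, u r <= b r) -> b @ \oo --> l ->
  (limn_esup (fun r => (u r)%:E) <= l%:E)%E.
Proof.
move=> ub bl.
have bE : (fun r => (b r)%:E) @ \oo --> l%:E by apply: cvg_EFin => //; exact: nearW.
have bsup := cvg_esups bE.
rewrite limn_esup_lim -(cvg_lim _ bsup)//.
apply: lee_lim; [exact: is_cvg_esups|exact: is_cvg_esups|].
apply: nearW => m; apply: ge_ereal_sup => _ [k /= mk <-].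
by apply: le_ereal_sup_tmp; exists (b k)%:E; [exists k|rewrite lee_fin].
Qed.

Lemma halving_cvg0 (R : realType) (u : R ^nat) d :
  (forall r, 0 <= u r <= d * 2^-1 ^+ r) -> u @ \oo --> 0.
Proof.
move=> ud; apply: (@squeeze_cvgr _ _ _ _ (cst 0) (geometric d 2^-1)).
- exact: nearW.
- exact: cvg_cst.
- by apply: cvg_geometric; rewrite ger0_norm ?invr_ge0// invf_lt1// ltr1n.
Qed.

(** * Quadratic convergence of the cycles *)

Theorem theorem5p4 (R : realType) (N : nat)
  (f : 'cV[cplx R]_N.+1 -> 'cV[cplx R]_N.+1) (s : 'cV[cplx R]_N.+1)
  (n : nat) (eta delta0 a D0 L K1 K2 K3 K3' : R)
  (hs : f s = s)
  (hrho : spectral_radius (Ft f s) < 1)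
  (heta : 0 < eta)
  (hdelta0 : 0 < delta0)
  (hA1 : C2_on (sball f s delta0) f)
  (hA2 : matnorm f s (Ft f s) <= L)
  (hLmax : exists2 x, sball f s delta0 x & matnorm f s (jac f x) = L)
  (hLub : forall x, sball f s delta0 x -> matnorm f s (jac f x) <= L)
  (hL : 0 < L < 1)
  (ha : 0 < a)
  (haf : forall x, sball f s delta0 x ->
     vecnorm f s (f x - s - Ft f s *m (x - s)) <= a * vecnorm f s (x - s) ^+ 2)
  (hD0 : D0 = a)
  (hK1 : 0 < K1) (hK2 : 0 < K2) (hK3 : 0 < K3) (hK3' : 0 < K3')
  (hK : RRE_constants f s delta0 K1 K2 K3 K3') :
  exists2 delta : R, 0 < delta <= delta0 &
    forall (x0 : 'cV[cplx R]_N.+1) (kq : nat -> nat)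
      (sq : nat -> 'cV[cplx R]_N.+1),
      sball f s delta x0 ->
      MC_mode f s x0 n kq sq ->
      (forall r, (1 <= r)%N -> cycle_err f s sq n r != 0) ->
      (forall r, (1 <= r)%N ->
         opnorm (mppinv (Wtmx f s (cycle_err f s sq n r) (kq r)))
           <= eta / vecnorm f s (cycle_err f s sq n r)) ->
      [/\ sq @ \oo --> s,
          cvgn (tau_n f s sq n L eta D0 K1 K2 K3 K3') &
          (limn_esup (fun r => (vecnorm f s (sq r.+1 - s) /
                                vecnorm f s (sq r - s) ^+ 2)%:E)
           <= (limn (tau_n f s sq n L eta D0 K1 K2 K3 K3')
               * L ^+ (2 * n))%:E)%E].
Proof.
subst D0; case/andP: hL => L0 L1.
have Gunit : Gmx f s \in unitmx by exact: unitmx_spectral_radius.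
set g := opnorm (invmx (Gmx f s)).
have g0 : 0 <= g by exact: opnorm_ge0.
pose rate := rre_rate eta a L K1 K2 K3 K3' g.
pose c := (K2 * eta * a +
  (K1 * (Num.sqrt 2 * (K3' * eta ^+ 2 * 4)) + K3 * eta) * 2) * g.
have c0 : 0 <= c.
  have r20 : 0 <= Num.sqrt 2 :> R by exact: sqrtr_ge0.
  by rewrite mulr_ge0// addr_ge0 ?mulr_ge0 ?addr_ge0 ?mulr_ge0 ?sqr_ge0 ?ltW.
(* The four bounds keep the iterates in the ball of radius [delta0], the base of the denominator in
   the rate at least 1/2, the contraction factor at most 1, and [c] times the error at most 1/2, so
   that each cycle halves the error. Using [c + 1] avoids a zero divisor. *)
pose delta := Num.min (Num.min delta0 (2 * (K3' * eta))^-1)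
  (Num.min ((1 - L) / a) (2 * (c + 1))^-1).
have delta_gt0 : 0 < delta.
  by rewrite !lt_min hdelta0 ?invr_gt0 ?divr_gt0 ?mulr_gt0 ?subr_gt0 ?ltr_wpDl.
have delta_le0 : delta <= delta0 by rewrite /delta !ge_min lexx.
have small t : 0 <= t <= delta ->
    [/\ t <= delta0, K3' * eta * t <= 2^-1, L + a * t <= 1 & c * t <= 2^-1].
  case/andP=> t0; rewrite /delta !le_min => /andP[/andP[h1 h2] /andP[h3 h4]].
  have c1 : 0 < 2 * (c + 1) by rewrite mulr_gt0// ltr_wpDl.
  have k0 : 0 < 2 * (K3' * eta) by rewrite !mulr_gt0.
  move: h2 h3 h4; rewrite ler_pdivlMr// -[_^-1]mul1r ler_pdivlMr//.
  rewrite -[X in _ -> _ -> t <= X -> _]mul1r ler_pdivlMr// => h2 h3 h4.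
  by split=> //; nra.
exists delta; first by rewrite delta_gt0.
move=> x0 kq sq x0B [sq0 sqS] eps0 stable.
pose e r := vecnorm f s (sq r - s).
have e0 r : 0 <= e r by exact: vecnorm_ge0.
have qe_ge0 r : 0 <= L + a * e r.
  exact: addr_ge0 (ltW L0) (mulr_ge0 (ltW ha) (e0 r)).
have step r : e r <= delta ->
    e r.+1 <= rate (e r) * (L + a * e r) ^+ (2 * n) * e r ^+ 2.
  move=> ed; have [er0 ke qe _] := small (e r) (introT andP (conj (e0 r) ed)).
  have [[P minP kP] sqE] := sqS r.+1 isT; rewrite [e r.+1]/e sqE.
  have := stable r.+1 isT; rewrite kP => st.
  apply: (rre_cycle_quadratic Gunit hA2 heta ha (ltW L0) hK1 hK2 hK3 hK3' haf hK
    er0 qe _ minP (eps0 r.+1 isT) st).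
  by apply: le_lt_trans ke _; rewrite invf_lt1// ltr1n.
(* The halving bound also returns [e r <= delta], which [step] requires in the next cycle. *)
have half r : e r <= delta * 2^-1 ^+ r.
  elim: r => [|r IH]; first by rewrite expr0 mulr1 /e sq0.
  have ed : e r <= delta.
    by apply: le_trans IH _; rewrite ler_piMr ?exprn_ile1 ?invr_ge0 ?invf_le1 ?ler1n// ltW.
  have [_ ke qe ce] := small (e r) (introT andP (conj (e0 r) ed)).
  have rc : rate (e r) <= c.
    by apply: rre_rate_le => //; exact: ltW.
  have q0 := qe_ge0 r.
  have rate_ge0 : 0 <= rate (e r) by apply: rre_rate_ge0 => //; exact: ltW.
  have rq : rate (e r) * (L + a * e r) ^+ (2 * n) <= c.
    rewrite -[c]mulr1; apply: ler_pM => //; last exact: exprn_ile1.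
    exact: exprn_ge0.
  apply: le_trans (step r ed) _; rewrite expr2 mulrA exprS mulrCA.
  apply: ler_pM => //; first exact: mulr_ge0 (mulr_ge0 rate_ge0 (exprn_ge0 _ q0)) (e0 r).
  by apply: le_trans ce; exact: ler_wpM2r.
have le_delta r : e r <= delta.
  by apply: le_trans (half r) _; rewrite ler_piMr ?exprn_ile1 ?invr_ge0 ?invf_le1 ?ler1n// ltW.
have ecvg : e @ \oo --> 0.
  by apply: (@halving_cvg0 _ _ delta) => r; rewrite e0 half.
have tau_cvg : tau_n f s sq n L eta a K1 K2 K3 K3' @ \oo --> rate 0.
  pose w r := vecnorm f s (cycle_err f s sq n r).
  have we r : w r <= e r.-1.
    have [er0 _ qe _] := small (e r.-1) (introT andP (conj (e0 _) (le_delta _))).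
    have [h _] := vecnorm_err_le Gunit hA2 (ltW ha) haf er0 qe (ltW L0) n.
    apply: le_trans h _; apply: ler_piMl (e0 _) _.
    exact: exprn_ile1 (qe_ge0 _) qe.
  have w0 : w @ \oo --> 0.
    (* Cycle [r] starts from index [r.-1]; the factor 2 absorbs this shift and also covers
       [r = 0]. *)
    apply: (@halving_cvg0 _ _ (2 * delta)) => r; rewrite vecnorm_ge0 /=.
    apply: le_trans (we r) _; apply: le_trans (half _) _.
    case: r => [|r] /=; first by rewrite !expr0 !mulr1 ler_peMl// ?ler1n// ltW.
    by rewrite exprS mulrA [2 * _]mulrC mulfK.
  have -> : rate 0 = (K2 * eta * a + (K1 * (Num.sqrt 2 * (K3' * eta ^+ 2 /
      (1 - K3' * eta * 0))) + K3 * eta) * (1 + L)) * g.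
    by rewrite /rate /rre_rate !mulr0 subr0 expr1n addr0.
  rewrite /tau_n -/g; apply: cvgM; last exact: cvg_cst.
  apply: cvgD; first exact: cvg_cst.
  apply: cvgM; last exact: cvg_cst.
  apply: cvgD; last exact: cvg_cst.
  apply: cvgM; first exact: cvg_cst.
  apply: cvgM; first exact: cvg_cst.
  apply: cvgM; first exact: cvg_cst.
  apply: cvgV; first by rewrite mulr0 subr0 oner_neq0.
  apply: cvgB; first exact: cvg_cst.
  by apply: cvgM => //; exact: cvg_cst.
split.
- apply: cvg_l2norm.
  apply: (@halving_cvg0 _ _ (g * delta)) => r; rewrite l2norm_ge0 /=.
  apply: le_trans (l2norm_le_vecnorm Gunit _) _.
  rewrite -mulrA; exact: ler_wpM2l g0 _ _ (half r).
- by apply/cvg_ex; exists (rate 0).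
rewrite (cvg_lim _ tau_cvg)//.
apply: (@limn_esup_le_lim _ _
  (fun r => rate (e r) * (L + a * e r) ^+ (2 * n))) => [r|].
  (* If the error vanishes, the quotient is 0 by the convention on division by zero, and the bound
     is nonnegative. *)
  have [er|er] := eqVneq (e r) 0.
    rewrite -/(e r) er expr0n invr0 mulr0.
    apply: mulr_ge0; last by rewrite mulr0 addr0 exprn_ge0// ltW.
    by apply: rre_rate_ge0 => //; exact: ltW.
  rewrite ler_pdivrMr; first exact: step r (le_delta r).
  by rewrite exprn_gt0// lt_def er e0.
have -> : rate 0 * L ^+ (2 * n) = rate 0 * (L + a * 0) ^+ (2 * n).
  by rewrite mulr0 addr0.
apply: cvgM; first exact: cvg_rre_rate.
have exprC : {for L + a * 0, continuous (fun x : R => x ^+ (2 * n))}.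
  exact: exprn_continuous.
apply: continuous_cvg exprC _.
apply: cvgD; first exact: cvg_cst.
by apply: cvgM => //; exact: cvg_cst.
Qed.
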